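(* Let $n\ge 2$ be an integer and let $\beta_1<\cdots<\beta_n$ be $n$ given real numbers. The following are equivalent. (i) The $\beta$'s are expected order statistics, that is, there exist i.i.d. integrable non-degenerate random variables $X_1,\ldots,X_n$ such that $\mathbb{E}X_{j:n}=\beta_j$ for $j=1,\ldots,n$. (ii) There exists a random variable $T$ with $\mathbb{P}(0<T<1)=1$ such that $$\frac{(j+1)(n-j-1)(\beta_{j+2}-\beta_{j+1})}{\sum_{i=1}^{n-1}i(n-i)(\beta_{i+1}-\beta_i)}=\mathbb{E}\left\{\binom{n-2}{j}T^j(1-T)^{n-2-j}\right\},\qquad j=0,\ldots,n-2.$$ (iii) There exists a random variable $T$ with $\mathbb{P}(0<T<1)=1$ such that $$\frac{n-1}{\binom{n-1}{k+1}\sum_{i=1}^{n-1}i(n-i)(\beta_{i+1}-\beta_i)}\sum_{j=k+1}^{n-1}(n-j)\binom{j}{k+1}(\beta_{j+1}-\beta_j)=\mathbb{E}T^k,\qquad k=0,\ldots,n-2.$$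
   Context: For i.i.d. real random variables $X_1,\ldots,X_n$, $X_{1:n}\le\cdots\le X_{n:n}$ denote the corresponding order statistics (the values $X_1,\dots,X_n$ arranged in nondecreasing order). A random variable is non-degenerate if it is not almost surely constant, and integrable if $\mathbb{E}|X|<\infty$. *)

(* Defs.v *)
From HB Require Import structures.
From mathcomp Require Import all_boot all_order all_algebra.
From mathcomp Require Import all_classical all_reals all_analysis.

Set Implicit Arguments.
Unset Strict Implicit.
Unset Printing Implicit Defensive.

Import Order.TTheory GRing.Theory Num.Theory.

Local Open Scope classical_set_scope.
Local Open Scope ring_scope.

Section random_variables.
Context {R : realType} {d : measure_display} {Omega : measurableType d}.
Variable P : probability Omega R.

Definition mutually_independent (I : finType) (X : I -> {RV P >-> R}) : Prop :=
  forall (J : {set I}) (A : I -> set R),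
    (forall i, i \in J -> measurable (A i)) ->
    P (\bigcap_(i in [set` J]) (X i @^-1` A i))
      = \big[mule/1%E]_(i in J) P (X i @^-1` A i).

Definition identically_distributed (I : Type) (X : I -> {RV P >-> R}) : Prop :=
  forall (i j : I) (A : set R),
    measurable A -> distribution P (X i) A = distribution P (X j) A.

Definition degenerate (X : {RV P >-> R}) : Prop :=
  exists c : R, {ae P, forall w, X w = c}.

(* Ranks are 1-based: order_stat X j is $X_{j:n}$ for 1 <= j <= n. *)
Definition order_stat (n : nat) (X : 'I_n -> {RV P >-> R}) (j : nat)
    (w : Omega) : R :=
  nth 0 (sort <=%R [seq X i w | i <- enum 'I_n]) j.-1.

End random_variables.

(* Only the values beta 1, ..., beta n are constrained. *)
Definition expected_order_stats (R : realType) (n : nat) (beta : nat -> R)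
    : Prop :=
  exists (d : measure_display) (Omega : measurableType d)
         (P : probability Omega R) (X : 'I_n -> {RV P >-> R}),
    [/\ mutually_independent X,
        identically_distributed X,
        forall i, P.-integrable setT (EFin \o X i),
        forall i, ~ degenerate (X i) &
        forall j, (1 <= j <= n)%N -> ('E_P[order_stat X j] = (beta j)%:E)%E].

(* Main.v *)
(* Write F for the distribution function of X_1 and N(x) for the number of
   X_i <= x.  Since X_{j:n} <= x < X_{j+1:n} exactly when N(x) = j, Tonelli gives
     E nu([X_{j:n}, X_{j+1:n}[) = C(n,j) \int F^j (1 - F)^(n-j) dnu
   for every sigma-finite nu.
   For (i) => (ii) take nu to be Lebesgue measure: the spacings become Bernstein
   moments of T = F under the probability of density proportional to F (1 - F),
   and n (n - 1) \int F (1 - F) is the sum S.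
   For (ii) => (i) let U_i be i.i.d. uniform, put nu(dt) = c P_T(dt) / (t (1 - t))
   with c = S / (n (n - 1)), and take X_i = G(U_i) + b where G is a primitive of nu;
   the same identity for the U_i computes the spacings of the X_i.
   (ii) <=> (iii), with the same T, is the triangular change of basis
     C(m,k) t^k = \sum_j C(j,k) B_{j,m}(t),  m = n - 2. *)

From HB Require Import structures.
Require Import Defs.
From mathcomp Require Import all_boot all_order all_algebra.
From mathcomp Require Import all_classical all_reals all_analysis.
From mathcomp Require Import measurable_realfun ring lra zify.
Import Order.TTheory GRing.Theory Num.Theory.
Local Open Scope classical_set_scope.
Local Open Scope ring_scope.

(** * Order statistics through counts: measurability, monotone images, integrability *)

(** There are finitely many [J], and prescribing the whole set of indices where [A i] holds is a
    finite intersection. The form with parameters serves both for counts on [Omega] and for counts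
    jointly measurable on a product. *)
Lemma measurable_finset_pred d (T : measurableType d) (I : finType)
    (A : I -> T -> bool) (Q : pred {set I}) :
  (forall i, measurable [set x | A i x]) ->
  measurable [set x | Q [set i | A i x]%SET].
Proof.
move=> mA.
rewrite (_ : [set x | _] = \bigcup_(J in [set` Q])
    \bigcap_(i in setT) [set x | A i x = (i \in J)]); last first.
  apply/seteqP; split => [x /= Qx|x [J /= QJ JA]].
    by exists [set i | A i x]%SET => // i _ /=; rewrite inE.
  suff -> : [set i | A i x]%SET = J by [].
  by apply/setP => i; rewrite inE; exact: JA.
apply: fin_bigcup_measurable => [|J _]; first exact: finite_finset.
apply: fin_bigcap_measurable => [|i _]; first exact: finite_finset.
case: (i \in J) => /=; first exact: mA.
rewrite (_ : [set x | _] = ~` [set x | A i x]); first exact: measurableC.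
by apply/seteqP; split => x /=; [move=> ->|move=> /negP/negbTE].
Qed.

Section order_statistics.
Context {R : realType} {d : measure_display} {Omega : measurableType d}.
Context {P : probability Omega R} {n : nat}.
Implicit Types (X : 'I_n -> {RV P >-> R}) (w : Omega) (x : R).

(** Sorting preserves the number of entries at most [x] and puts them first, so rank [j] falls among
    them exactly when there are at least [j]. *)
Lemma order_stat_le X j w x : (0 < j <= n)%N ->
  (order_stat X j w <= x) = (j <= #|[set i | (X i w <= x)%R]%SET|)%N.
Proof.
case: j => // j /= jn; rewrite /order_stat.
set s := [seq X i w | i <- enum 'I_n].
have sz : size (sort <=%R s) = n by rewrite size_sort size_map size_enum_ord.
have srt : sorted <=%R (sort <=%R s) by exact/sort_sorted/le_total.
have -> : #|[set i | (X i w <= x)%R]%SET| = count (<= x) (sort <=%R s).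
  rewrite count_sort count_map cardE size_filter enumT.
  by apply: eq_count => i /=; rewrite inE.
have [jc|jc] := ltnP; first by rewrite (nth_count_le _ srt jc).
by apply/negbTE; rewrite -ltNge nth_count_gt// jc sz.
Qed.

Lemma order_stat_between X j w x : (0 < j < n)%N ->
  (order_stat X j w <= x < order_stat X j.+1 w)
    = (#|[set i | (X i w <= x)%R]%SET| == j).
Proof.
move=> /andP[j0 jn]; rewrite ltNge !order_stat_le ?j0 ?(ltnW jn)//.
by rewrite -ltnNge ltnS eqn_leq andbC.
Qed.

Lemma le_order_stat X i j w : (0 < i <= j)%N -> (j <= n)%N ->
  order_stat X i w <= order_stat X j w.
Proof.
(* The comparison is read as a count at the level x = X_{j:n}, where at least [j >= i] values lie
   below. *)
move=> /andP[i0 ij] jn; rewrite order_stat_le ?i0 ?(leq_trans ij jn)//.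
by apply: (leq_trans ij); rewrite -order_stat_le// jn (leq_trans i0 ij).
Qed.

Lemma order_stat_mem X j w : (0 < j <= n)%N ->
  exists i, order_stat X j w = X i w.
Proof.
case: j => // j /= jn; rewrite /order_stat /=.
set s := [seq X i w | i <- enum 'I_n].
have : nth 0 (sort <=%R s) j \in s.
  by rewrite -(mem_sort <=%R) mem_nth// size_sort size_map size_enum_ord.
by move=> /mapP[i _ ->]; exists i.
Qed.

(** A nondecreasing map sends the sorted list to a sorted permutation of the images, and such a list
    is unique. Monotonicity is asked on [D] only, because the primitive G built below is shown
    monotone only on ]0, 1[. *)
Lemma order_stat_comp X (Y : 'I_n -> {RV P >-> R}) (g : R -> R) (D : {pred R})
    j w : (0 < j <= n)%N ->
  {in D &, {homo g : x y / x <= y}} ->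
  (forall i, X i w \in D) -> (forall i, Y i w = g (X i w)) ->
  order_stat Y j w = g (order_stat X j w).
Proof.
case: j => // j /= jn ghomo XD YgX; rewrite /order_stat /=.
rewrite (eq_map YgX) (map_comp g (X^~ w)).
set s := [seq X i w | i <- enum 'I_n].
have sD : all (mem D) s by apply/allP => _ /mapP[i _ ->]; exact: XD.
suff -> : sort <=%R (map g s) = map g (sort <=%R s).
  by rewrite (nth_map 0)// size_sort size_map size_enum_ord.
apply: (@sorted_eq _ <=%R); [exact: le_trans|exact: le_anti| | |].
- exact/sort_sorted/le_total.
- apply: (@homo_sorted_in _ _ (mem D) g <=%R <=%R) => //.
  + by rewrite all_sort.
  + exact/sort_sorted/le_total.
- by rewrite perm_sort perm_map// perm_sym perm_sort.
Qed.

Lemma measurable_order_stat X j : (0 < j <= n)%N ->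
  measurable_fun setT (order_stat X j).
Proof.
move=> jn; apply: (measurability (@RGenOInfty.G R)).
  exact: RGenOInfty.measurableE.
move=> _ [_ [x ->] <-]; rewrite setTI.
rewrite (_ : _ @^-1` _ =
    ~` [set w | (j <= #|[set i | (X i w <= x)%R]%SET|)%N]); last first.
  apply/seteqP; split => w /=; rewrite in_itv/= andbT ltNge order_stat_le//.
    by move=> /negP.
  by move=> /negP.
apply: measurableC.
apply: (@measurable_finset_pred _ _ _ (fun i w => X i w <= x)
  (fun J => (j <= #|J|)%N)) => i.
rewrite -[X in measurable X]setTI.
by apply: measurable_fun_le => //; exact: measurable_cst.
Qed.

Lemma measurable_order_stat_between {d'} {T' : measurableType d'} X
    (tau : T' -> R) j :
  (0 < j < n)%N -> measurable_fun setT tau ->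
  measurable [set z : Omega * T' |
     order_stat X j z.1 <= tau z.2 < order_stat X j.+1 z.1].
Proof.
move=> jn mtau.
under eq_set do rewrite order_stat_between//.
apply: (@measurable_finset_pred _ _ _ (fun i z => X i z.1 <= tau z.2)
  (fun J => #|J| == j)) => i.
rewrite -[X in measurable X]setTI.
by apply: measurable_fun_le => //; exact: measurableT_comp.
Qed.

(** At each point an order statistic is one of the [X i w], hence is dominated by the sum of their
    absolute values. *)
Lemma integrable_order_stat X j : (0 < j <= n)%N ->
  (forall i, P.-integrable setT (EFin \o X i)) ->
  P.-integrable setT (EFin \o order_stat X j).
Proof.
move=> jn iX.
apply: (@le_integrable _ _ _ _ _ _ _
    (fun w => \sum_(i < n) (`|X i w|)%:E)%E) => //.
- exact/measurable_EFinP/measurable_order_stat.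
- move=> w _ /=; rewrite sumEFin lee_fin.
  rewrite [leRHS]ger0_norm ?sumr_ge0//.
  have [i ->] := @order_stat_mem X j w jn.
  by rewrite (bigD1 i)//= lerDl sumr_ge0.
- apply: integrable_sum => // i _.
  exact/integrable_norm.
Qed.

End order_statistics.

(** * Binomial law of the count N(x) and the spacing identity *)

Section independent_counts.
Context {R : realType} {d : measure_display} {Omega : measurableType d}.
Context {P : probability Omega R} {n : nat} {X : 'I_n -> {RV P >-> R}}.
Hypothesis indX : mutually_independent X.

(** The event splits according to the set [J] of indices with [X i w <= x]; independence gives each
    of the C(n,j) pieces the same probability. *)
Lemma prob_count_le (x F : R) (j : nat) :
  (forall i, P (X i @^-1` `]-oo, x]) = F%:E) ->
  P [set w | #|[set i | (X i w <= x)%R]%SET| == j]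
    = ('C(n, j)%:R * (F ^+ j * (1 - F) ^+ (n - j)))%:E.
Proof.
move=> PF.
pose A (J : {set 'I_n}) i : set R :=
  if i \in J then `]-oo, x]%classic else `]x, +oo[%classic.
have mA J i : measurable (A J i).
  by rewrite /A; case: ifP.
have mXx i : measurable (X i @^-1` `]-oo, x]) by exact: measurable_funPTI.
(* [E J] says that the indices with [X i w <= x] are exactly those in [J]: the indices outside [J]
   are constrained too, which makes these events disjoint. *)
pose E (J : {set 'I_n}) := \bigcap_(i in [set` [set: 'I_n]%SET]) (X i @^-1` A J i).
have mE J : measurable (E J).
  apply: fin_bigcap_measurable => [|i _]; first exact: finite_finset.
  exact: measurable_funPTI.
have EP J w : E J w <-> [set i | (X i w <= x)%R]%SET = J.
  split=> [Ew|<- i _ /=].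
    apply/setP => i; have := Ew i; rewrite /= !inE /A => /(_ isT).
    by case: (i \in J) => /=; rewrite in_itv/= ?andbT// ltNge => /negbTE.
  by rewrite /A inE; case: ifPn => /=; rewrite in_itv/= ?andbT// -ltNge.
have PE J : P (E J) = (F ^+ #|J| * (1 - F) ^+ (n - #|J|))%:E.
  rewrite indX// (bigID (mem J))/=.
  rewrite (eq_bigr (fun=> F%:E)); last first.
    by move=> i /andP[_ iJ]; rewrite /A iJ PF.
  rewrite [X in (_ * X)%E](eq_bigr (fun=> (1 - F)%:E)); last first.
    move=> i /andP[_ /negbTE iJ]; rewrite /A iJ -setCitvl preimage_setC.
    by rewrite probability_setC ?PF//; exact: mXx.
  rewrite !prodEFin -EFinM !prodr_const.
  congr ((_ ^+ _ * _ ^+ _)%:E).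
    by apply: eq_card => i; rewrite unfold_in/= inE.
  have -> : (n - #|J| = #|[predC J]|)%N.
    by rewrite -{1}(card_ord n) -(cardC (mem J)) addKn.
  by apply: eq_card => i; rewrite [LHS]unfold_in/= !inE.
pose s := enum [pred J : {set 'I_n} | #|J| == j].
rewrite (_ : [set w | _] = \bigcup_(J in [set` s]) E J); last first.
  apply/seteqP; split => [w /= wj|w [J /=]].
    exists [set i | (X i w <= x)%R]%SET; last exact/EP.
    by rewrite /= mem_enum inE.
  by rewrite mem_enum inE => /eqP<- /EP ->.
rewrite measure_fin_bigcup//; last first.
  apply/trivIsetP => I J _ _ /eqP IJ; apply/seteqP; split => // w.
  by move=> [/EP wI /EP wJ]; case: IJ; rewrite -wI -wJ.
rewrite -fsbig_seq ?enum_uniq//= /s big_enum/=.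
rewrite (eq_bigr (fun=> (F ^+ j * (1 - F) ^+ (n - j))%:E)); last first.
  by move=> J; rewrite inE PE => /eqP ->.
rewrite sumEFin sumr_const/= mulr_natl.
congr ((_ *+ _)%:E).
rewrite -[in RHS](card_ord n) -card_draws.
by apply: eq_card => J; rewrite !inE.
Qed.

(** The threshold [tau] and the weight [g] cover both uses: Lebesgue measure with [tau] the identity
    and [g] equal to 1, and the law of a variable [T] with [tau := T] and a density [g]. Tonelli
    reduces it to the binomial law at each fixed [t]. *)
Lemma integral_order_stat_between d' (T' : measurableType d')
    (nu : {sigma_finite_measure set T' -> \bar R}) (tau g F : T' -> R) (j : nat) :
  (0 < j < n)%N ->
  measurable_fun setT tau -> measurable_fun setT g -> (forall t, 0 <= g t) ->
  (forall t i, P (X i @^-1` `]-oo, tau t]) = (F t)%:E) ->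
  (\int[P]_w \int[nu]_t
     (g t * (order_stat X j w <= tau t < order_stat X j.+1 w)%R%:R)%:E
   = \int[nu]_t
     (g t * ('C(n, j)%:R * (F t ^+ j * (1 - F t) ^+ (n - j))))%:E)%E.
Proof.
move=> jn mtau mg g0 PF.
pose f (z : Omega * T') :=
  (g z.2 * (order_stat X j z.1 <= tau z.2 < order_stat X j.+1 z.1)%R%:R)%:E.
have mf : measurable_fun setT f.
  apply/measurable_EFinP/measurable_funM; first exact: measurableT_comp.
  rewrite (_ : (fun _ => _) = \1_[set z : Omega * T' |
      order_stat X j z.1 <= tau z.2 < order_stat X j.+1 z.1]).
    by apply: measurable_indic; exact: measurable_order_stat_between.
  apply/funext => z; rewrite indicE; congr (nat_of_bool _)%:R.
  by apply/idP/idP; rewrite inE.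
have f0 z : (0 <= f z)%E by rewrite lee_fin mulr_ge0.
rewrite (fubini_tonelli f mf f0).
apply: eq_integral => t _; rewrite /f /=.
pose B := [set w | #|[set i | (X i w <= tau t)%R]%SET| == j].
have mB : measurable B.
  apply: (@measurable_finset_pred _ _ _ (fun i w => X i w <= tau t)
    (fun J => #|J| == j)) => i.
  rewrite -[X in measurable X]setTI.
  by apply: measurable_fun_le => //; exact: measurable_cst.
transitivity (\int[P]_w ((g t)%:E * (\1_B w)%:E))%E.
  apply: eq_integral => w _; rewrite -EFinM; congr ((_ * _)%:E).
  rewrite order_stat_between// indicE; congr (nat_of_bool _)%:R.
  by apply/idP/idP; rewrite inE.
rewrite ge0_integralZl//; last 2 first.
- exact/measurable_EFinP/measurable_indic.
- by rewrite lee_fin.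
rewrite integral_indic// setIT EFinM; congr (_ * _)%E.
exact: prob_count_le.
Qed.

End independent_counts.

(** * Binomial identities and Bernstein polynomials *)

Lemma bin_mul_bin (m j k : nat) : (k <= j <= m)%N ->
  ('C(j, k) * 'C(m, j) = 'C(m, k) * 'C(m - k, j - k))%N.
Proof.
move=> /andP[kj jm]; have km := leq_trans kj jm.
(* Multiplied by k! (j-k)! (m-j)!, both sides become m!. *)
apply/eqP; rewrite -(eqn_pmul2r (fact_gt0 k)) -(eqn_pmul2r (fact_gt0 (j - k))).
rewrite -(eqn_pmul2r (fact_gt0 (m - j))).
have h1 := bin_fact kj; have h2 := bin_fact jm; have h3 := bin_fact km.
have h4 := @bin_fact (m - k) (j - k) (leq_sub2r _ jm).
have E : (m - k - (j - k) = m - j)%N by lia.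
rewrite E in h4.
apply/eqP; transitivity (m`!).
  by rewrite -h2 -h1; nia.
by rewrite -h3 -h4; nia.
Qed.

Section bernstein.
Context {R : realType}.
Implicit Types (t : R) (m j k : nat).

Definition bernstein m j t : R := 'C(m, j)%:R * t ^+ j * (1 - t) ^+ (m - j).

(** These are the factorial moments of the binomial law: after [bin_mul_bin] the remaining sum is
    the expansion of ((1 - t) + t)^(m-k). The case [k = 0] is the partition of unity used repeatedly
    below. *)
Lemma sum_bin_bernstein m k t : (k <= m)%N ->
  \sum_(j < m.+1) 'C(j, k)%:R * bernstein m j t = 'C(m, k)%:R * t ^+ k.
Proof.
move=> km; rewrite -(big_mkord xpredT (fun j => 'C(j, k)%:R * bernstein m j t)).
rewrite (@big_cat_nat _ _ _ k)//=; last by rewrite leqW.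
rewrite big_nat big1 ?add0r; last first.
  by move=> j /= jk; rewrite bin_small ?mul0r.
rewrite -{1}[k]add0n big_addn subSn// big_mkord.
have -> : 'C(m, k)%:R * t ^+ k = 'C(m, k)%:R * t ^+ k * ((1 - t) + t) ^+ (m - k).
  by rewrite subrK expr1n mulr1.
rewrite exprDn mulr_sumr; apply: eq_bigr => i _.
have im : (i <= m - k)%N by rewrite -ltnS.
rewrite /bernstein !mulrA -natrM bin_mul_bin; last by lia.
rewrite addnK natrM exprD -mulr_natr.
have -> : (m - (i + k) = m - k - i)%N by lia.
ring.
Qed.

(** The matrix C(j,k) is unitriangular: the equation of highest index [k] contains only the last
    coefficient, and the others follow by descent. *)
Lemma bin_triangular m (c : nat -> R) :
  (forall k, (k <= m)%N -> \sum_(j < m.+1) 'C(j, k)%:R * c j = 0) ->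
  forall j, (j <= m)%N -> c j = 0.
Proof.
elim: m => [|m IH] h j jm.
  have := h 0 isT; rewrite big_ord1 bin0 mul1r.
  by move: jm; rewrite leqn0 => /eqP->.
have cm : c m.+1 = 0.
  have := h _ (leqnn _); rewrite big_ord_recr/= binn mul1r big1 ?add0r// => i _.
  by rewrite bin_small ?mul0r.
move: jm; rewrite leq_eqVlt => /predU1P[->//|].
rewrite ltnS; apply: IH => k km.
by have := h k (leqW km); rewrite big_ord_recr/= cm mulr0 addr0.
Qed.

Lemma bernstein_ge0 m j t : 0 <= t <= 1 -> 0 <= bernstein m j t.
Proof.
by move=> /andP[t0 t1]; rewrite /bernstein !mulr_ge0// exprn_ge0// subr_ge0.
Qed.

Lemma bernstein_le1 m j t : (j <= m)%N -> 0 <= t <= 1 -> bernstein m j t <= 1.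
Proof.
move=> jm t01; have := sum_bin_bernstein m 0 t isT.
rewrite bin0 expr0 mulr1 (bigD1 (Ordinal (jm : (j < m.+1)%N)))//=.
rewrite bin0 mul1r => bE; rewrite -[leRHS]bE lerDl sumr_ge0// => i _.
by rewrite bin0 mul1r bernstein_ge0.
Qed.

Lemma measurable_bernstein m j : measurable_fun [set: R] (bernstein m j).
Proof.
apply: measurable_funM; first apply: measurable_funM => //.
apply: measurable_funX; exact: measurable_funB.
Qed.

End bernstein.

(** With n = m + 2, (j+1) (n-j-1) C(n,j+1) = n (n-1) C(m,j). The factor t (1 - t) that comes out is
    the source of the density F (1 - F) in one direction and of the weight 1 / (t (1 - t)) in the
    other. *)
Lemma bin_bernsteinE (R : realType) (m j : nat) (t : R) : (j <= m)%N ->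
  j.+1%:R * (m.+2 - j - 1)%:R *
    ('C(m.+2, j.+1)%:R * (t ^+ j.+1 * (1 - t) ^+ (m.+2 - j.+1)))
  = m.+2%:R * m.+1%:R * (t * (1 - t) * bernstein m j t).
Proof.
move=> jm; rewrite /bernstein.
have -> : (m.+2 - j - 1 = m.+1 - j)%N by lia.
have -> : (m.+2 - j.+1 = (m - j).+1)%N by lia.
have e1 : m.+2%:R * 'C(m.+1, j)%:R = j.+1%:R * 'C(m.+2, j.+1)%:R :> R.
  by rewrite -!natrM -(mul_bin_diag m.+2).
have e2 : m.+1%:R * 'C(m, j)%:R = (m.+1 - j)%:R * 'C(m.+1, j)%:R :> R.
  by rewrite -!natrM -(mul_bin_down m.+1).
transitivity ((j.+1%:R * 'C(m.+2, j.+1)%:R) * (m.+1 - j)%:R *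
   (t ^+ j.+1 * (1 - t) ^+ (m - j).+1)); first by ring.
rewrite -e1 -[_ * _ * (m.+1 - j)%:R]mulrA [_ * (m.+1 - j)%:R]mulrC -e2 !exprS.
ring.
Qed.

(** This is the change of basis from (ii) to (iii) on the left-hand sides. The index shifts by one,
    the terms with [j < k] vanish, and the coefficients agree by two absorption identities for
    binomials. *)
Lemma moment_coefE (R : realType) (n k : nat) (S : R) (beta : nat -> R) :
  (2 <= n)%N -> (k <= n - 2)%N ->
  (n - 1)%:R / ('C(n - 1, k.+1)%:R * S)
    * \sum_(k.+1 <= j < n)
        (n - j)%:R * 'C(j, k.+1)%:R * (beta j.+1 - beta j)
  = (\sum_(j < (n - 2).+1) 'C(j, k)%:R *
      (j.+1%:R * (n - j - 1)%:R * (beta j.+2 - beta j.+1) / S))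
    / 'C(n - 2, k)%:R.
Proof.
case: n => [|[|m]]//= _; rewrite !subSS !subn0 => km.
rewrite [in RHS]mulr_suml [in LHS]mulr_sumr big_add1/=.
rewrite -[in RHS](big_mkord xpredT (fun j => 'C(j, k)%:R *
  (j.+1%:R * (m.+2 - j - 1)%:R * (beta j.+2 - beta j.+1) / S) / 'C(m, k)%:R)).
rewrite [RHS](@big_cat_nat _ _ _ k)//=; last by rewrite leqW.
rewrite [X in _ = X + _]big_nat [X in _ = X + _]big1 ?add0r; last first.
  by move=> j /= jk; rewrite bin_small ?mul0r.
apply: eq_bigr => j _.
have -> : (m.+2 - j - 1 = m.+1 - j)%N by lia.
rewrite subSS.
have c1 : 'C(m, k)%:R != 0 :> R by rewrite pnatr_eq0 -lt0n bin_gt0.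
have c2 : 'C(m.+1, k.+1)%:R != 0 :> R by rewrite pnatr_eq0 -lt0n bin_gt0.
have e1 : j.+1%:R * 'C(j, k)%:R = k.+1%:R * 'C(j.+1, k.+1)%:R :> R.
  by rewrite -!natrM -(mul_bin_diag j.+1 k).
have e2 : m.+1%:R * 'C(m, k)%:R = k.+1%:R * 'C(m.+1, k.+1)%:R :> R.
  by rewrite -!natrM -(mul_bin_diag m.+1 k).
have k0 : k.+1%:R != 0 :> R by rewrite pnatr_eq0.
transitivity ((j.+1%:R * 'C(j, k)%:R) * (m.+1 - j)%:R * (beta j.+2 - beta j.+1)
  / S / 'C(m, k)%:R); last by ring.
rewrite e1 invfM.
have -> : m.+1%:R = k.+1%:R * 'C(m.+1, k.+1)%:R / 'C(m, k)%:R :> R.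
  by rewrite -e2 mulfK.
(* [S] enters both sides only through its inverse; generalizing it keeps [field] from asking for
   [S != 0]. *)
move: (S^-1) => iS.
by field; rewrite c1 c2.
Qed.

(** * Variables with values in ]0, 1[ and their Bernstein moments *)

Definition rv_of_fun {R : realType} {d} {Omega : measurableType d}
    (P : probability Omega R) (f : Omega -> R) (mf : measurable_fun setT f) :
    {RV P >-> R} :=
  HB.pack f (isMeasurableFun.Build _ _ _ _ f mf).

(** The value 1/2 is an arbitrary point of ]0, 1[; composing with this map turns almost sure
    membership into membership everywhere. *)
Definition clamp01 {R : realType} (x : R) : R := if 0 < x < 1 then x else 2^-1.

Section clamp.
Context {R : realType}.
Implicit Type x : R.

Lemma clamp01_itv x : 0 < clamp01 x < 1.
Proof. by rewrite /clamp01; case: ifP => // _; lra. Qed.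

Lemma clamp01_id x : 0 < x < 1 -> clamp01 x = x.
Proof. by rewrite /clamp01 => ->. Qed.

Lemma measurable_clamp01 : measurable_fun [set: R] clamp01.
Proof.
apply: measurable_fun_if => //=.
by apply: measurable_and; apply: measurable_fun_ltr.
Qed.

(** Clamping changes [T] on a null set only, so later arguments may assume the bounds pointwise. *)
Lemma exists_unit_interval_rv d (Omega : measurableType d)
    (P : probability Omega R) (T : {RV P >-> R}) :
  P [set w | 0 < T w < 1] = 1%E ->
  exists2 T' : {RV P >-> R}, (forall w, 0 < T' w < 1) &
    forall g, measurable_fun setT g ->
      ('E_P[fun w => g (T w)] = 'E_P[fun w => g (T' w)])%E.
Proof.
have mT : measurable_fun setT (fun w => clamp01 (T w)).
  by apply: measurableT_comp => //; exact: measurable_clamp01.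
move=> PT; exists (rv_of_fun P _ mT) => [w|g mg].
  exact: clamp01_itv.
have mA : measurable [set w | 0 < T w < 1].
  rewrite (_ : [set w | _] = T @^-1` `]0, 1[); first exact: measurable_funPTI.
  by apply/seteqP; split => w /=; rewrite in_itv/=.
have PA : P (~` [set w | 0 < T w < 1]) = 0%E.
  by rewrite probability_setC// PT subee.
rewrite unlock; apply: ae_eq_integral => //.
- by apply/measurable_EFinP; apply: measurableT_comp.
- by apply/measurable_EFinP; apply: measurableT_comp.
- exists (~` [set w | 0 < T w < 1]); split.
  + exact: measurableC.
  + exact: PA.
  + by move=> w /= + wT; apply => _; rewrite clamp01_id.
Qed.

End clamp.

Section bernstein_moments.
Context {R : realType} {d : measure_display} {Omega : measurableType d}.
Context {P : probability Omega R} (T : {RV P >-> R}).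
Hypothesis T01 : forall w, 0 < T w < 1.

Let T_le01 w : 0 <= T w <= 1.
Proof. by have /andP[/ltW -> /ltW ->] := T01 w. Qed.

Lemma integrable_bernstein m j : (j <= m)%N ->
  P.-integrable setT (EFin \o (bernstein m j \o T)).
Proof.
move=> jm; apply: measurable_bounded_integrable => //.
- by rewrite (le_lt_trans (probability_le1 P measurableT))// ltry.
- by apply: measurableT_comp => //; exact: measurable_bernstein.
- exists 1; split; first exact: num_real.
  move=> x x1 w _ /=; rewrite ger0_norm ?bernstein_ge0//.
  by rewrite (le_trans (bernstein_le1 _ _ _ jm (T_le01 w)))// ltW.
Qed.

Lemma sum_bin_expectation_bernstein m k : (k <= m)%N ->
  (\sum_(j < m.+1) 'C(j, k)%:R%:E * 'E_P[fun w => bernstein m j (T w)]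
   = 'C(m, k)%:R%:E * 'E_P[fun w => (T w ^+ k)%R])%E.
Proof.
move=> km; rewrite !expectation.unlock.
have iB (j : 'I_m.+1) := integrable_bernstein m j (ltn_ord j : (j <= m)%N).
transitivity (\sum_(j < m.+1)
    \int[P]_w ('C(j, k)%:R%:E * (bernstein m j (T w))%:E))%E.
  by apply: eq_bigr => j _; rewrite integralZl//; exact: iB.
rewrite -integral_sum//; last by move=> j; apply: integrableZl => //; exact: iB.
rewrite -ge0_integralZl//; last 2 first.
- by apply/measurable_EFinP; exact: measurable_funX.
- move=> w _; rewrite lee_fin exprn_ge0// ltW//.
  by have /andP[] := T01 w.
apply: eq_integral => w _.
under eq_bigr do rewrite -EFinM.
by rewrite sumEFin -EFinM sum_bin_bernstein.
Qed.

Lemma expectation_bernstein_fin_num m j : (j <= m)%N ->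
  'E_P[fun w => bernstein m j (T w)]%E \is a fin_num.
Proof.
by move=> jm; rewrite unlock; apply: integrable_fin_num => //;
  exact: integrable_bernstein.
Qed.

Lemma expectation_exprn_fin_num k :
  'E_P[fun w => (T w ^+ k)%R]%E \is a fin_num.
Proof.
rewrite (_ : (fun w => _) = (fun w => bernstein k k (T w))).
  exact: expectation_bernstein_fin_num.
by apply/funext => w; rewrite /bernstein binn subnn expr0 mul1r mulr1.
Qed.

(** One direction integrates [sum_bin_bernstein]. In the other, the differences between [a j] and
    the Bernstein moments satisfy a homogeneous triangular system, hence vanish. *)
Lemma bernstein_moments_iff m (a : nat -> R) :
  (forall j, (j <= m)%N -> (a j)%:E = 'E_P[fun w => bernstein m j (T w)]%E) <->
  (forall k, (k <= m)%N ->
     ((\sum_(j < m.+1) 'C(j, k)%:R * a j) / 'C(m, k)%:R)%:E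
     = 'E_P[fun w => (T w ^+ k)%R]%E).
Proof.
split=> [aE k km|aE j jm].
  have C0 : 'C(m, k)%:R != 0 :> R by rewrite pnatr_eq0 -lt0n bin_gt0.
  rewrite -(fineK (expectation_exprn_fin_num k)); congr EFin.
  apply: (mulfI C0); rewrite mulrC divfK//; apply: EFin_inj.
  rewrite EFinM fineK ?expectation_exprn_fin_num//.
  rewrite -sum_bin_expectation_bernstein// -sumEFin.
  by apply: eq_bigr => j _; rewrite EFinM aE// -ltnS.
pose e j := fine 'E_P[fun w => bernstein m j (T w)]%E.
have eE i : (i <= m)%N -> 'E_P[fun w => bernstein m i (T w)]%E = (e i)%:E.
  by move=> im; rewrite fineK// expectation_bernstein_fin_num.
rewrite eE//; congr EFin; apply/eqP; rewrite -subr_eq0; apply/eqP.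
apply: (@bin_triangular _ m (fun j => a j - e j)) => // k km.
have C0 : 'C(m, k)%:R != 0 :> R by rewrite pnatr_eq0 -lt0n bin_gt0.
under eq_bigr do rewrite mulrBr.
rewrite sumrB; apply/eqP; rewrite subr_eq0; apply/eqP; apply: EFin_inj.
rewrite -[X in EFin X](divfK C0) mulrC EFinM aE//.
rewrite -sum_bin_expectation_bernstein// -sumEFin.
by apply: eq_bigr => i _; rewrite EFinM eE// -ltnS.
Qed.

End bernstein_moments.

(** * Probabilities given by a density *)

Lemma integral_itv_indic (R : realType) (a b : R) : a <= b ->
  (\int[lebesgue_measure]_x ((a <= x < b)%R%:R)%:E = (b - a)%:E)%E.
Proof.
move=> ab; rewrite (_ : (fun _ => _) = EFin \o \1_(`[a, b[%classic)); last first.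
  apply/funext => x /=; rewrite indicE; congr ((nat_of_bool _)%:R%:E).
  by apply/idP/idP; rewrite inE/= in_itv.
rewrite integral_indic//= setIT lebesgue_measure_itv/= lte_fin.
by case: ltgtP ab => // -> _; rewrite subrr.
Qed.

Section density.
Context {R : realType} {d : measure_display} {T : measurableType d}.
Variables (mu : {sigma_finite_measure set T -> \bar R}) (g : T -> R).

(** The proofs about [g] are arguments so that the probability structure can be attached to the term
    itself. *)
Definition density_prob (mg : measurable_fun setT g) (g0 : forall x, 0 <= g x)
    (g1 : (\int[mu]_x (g x)%:E = 1)%E) : set T -> \bar R :=
  fun A => (\int[mu]_(x in A) (g x)%:E)%E.

Hypothesis mg : measurable_fun setT g.
Hypothesis g0 : forall x, 0 <= g x.
Hypothesis g1 : (\int[mu]_x (g x)%:E = 1)%E.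

Local Notation nu := (density_prob mg g0 g1).

Let nu0 : nu set0 = 0%E.
Proof. by rewrite /density_prob integral_set0. Qed.

Let nu_ge0 A : (0 <= nu A)%E.
Proof. by apply: integral_ge0 => x _; rewrite lee_fin. Qed.

Let nu_sigma_additive : semi_sigma_additive nu.
Proof.
move=> /= F mF tF mUF; rewrite /density_prob; apply: cvg_toP.
  apply: ereal_nondecreasing_is_cvgn => m n mn.
  apply: lee_sum_nneg_natr => // k _ _.
  by apply: integral_ge0 => /= x Fkx; rewrite lee_fin.
rewrite ge0_integral_bigcup//=.
- by apply: measurable_funTS; apply/measurable_EFinP.
- by move=> x _; rewrite lee_fin.
Qed.

HB.instance Definition _ := isMeasure.Build _ _ _ nu nu0 nu_ge0 nu_sigma_additive.

HB.instance Definition _ := @Measure_isProbability.Build _ _ R nu g1.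

(* Writing f(x) as the length of [0, f(x)[, both sides become the same
   iterated integral by Tonelli. *)
Lemma integral_density_prob (f : T -> R) :
  measurable_fun setT f -> (forall x, 0 <= f x) ->
  (\int[nu]_x (f x)%:E = \int[mu]_x (g x * f x)%:E)%E.
Proof.
move=> mf f0.
pose B := [set z : T * measurableTypeR R | 0 <= z.2 < f z.1].
have mB : measurable B.
  rewrite -[B]setTI; apply: measurable_and => //.
    by apply: measurable_fun_ler => //; exact: measurable_cst.
  by apply: measurable_fun_ltr => //; exact: measurableT_comp.
pose h (z : T * measurableTypeR R) := ((0 <= z.2 < f z.1)%R%:R : R).
have hB : h = \1_B.
  apply/funext => z; rewrite indicE; congr (nat_of_bool _)%:R.
  by apply/idP/idP; rewrite inE.
have mh : measurable_fun setT h by rewrite hB; exact: measurable_indic.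
have h0 z : 0 <= h z by rewrite /h.
have fE x : ((f x)%:E = \int[lebesgue_measure]_y (h (x, y))%:E)%E.
  by rewrite /h/= integral_itv_indic// subr0.
pose hE z := (h z)%:E; pose ghE z := (g z.1 * h z)%:E.
transitivity (\int[nu]_x \int[lebesgue_measure]_y hE (x, y))%E.
  by apply: eq_integral => x _; rewrite fE.
rewrite (fubini_tonelli hE); last 2 first.
- exact/measurable_EFinP.
- by move=> z; rewrite lee_fin.
transitivity (\int[lebesgue_measure]_y \int[mu]_x ghE (x, y))%E.
  apply: eq_integral => y _.
  pose By := [set x | 0 <= y < f x].
  have mBy : measurable By.
    rewrite -[By]setTI; apply: measurable_and => //.
    exact: measurable_fun_ltr.
  transitivity (\int[nu]_x (\1_By x)%:E)%E.
    apply: eq_integral => x _; rewrite /hE /h indicE; congr ((nat_of_bool _)%:R%:E).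
    by apply/idP/idP; rewrite inE.
  rewrite integral_indic// setIT /= /density_prob.
  rewrite integral_mkcond; apply: eq_integral => x _.
  rewrite patchE /ghE /h/=.
  case: ifPn; rewrite ?notin_setE ?inE /By/=.
    by move=> ->; rewrite mulr1.
  by move=> /negP/negbTE ->; rewrite mulr0.
rewrite -(fubini_tonelli ghE); last 2 first.
- by apply/measurable_EFinP; apply: measurable_funM => //; exact: measurableT_comp.
- by move=> z; rewrite lee_fin mulr_ge0.
apply: eq_integral => x _ /=.
transitivity (\int[lebesgue_measure]_y ((g x)%:E * hE (x, y)))%E.
  by apply: eq_integral => y _; rewrite -EFinM.
rewrite ge0_integralZl//.
- by rewrite -fE EFinM.
- by apply/measurable_EFinP; apply: measurableT_comp.
- by move=> y _; rewrite lee_fin.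
- by rewrite lee_fin.
Qed.

End density.

(** * From order statistics to Bernstein moments: (i) implies (ii) *)

Section spacings.
Context {R : realType} {d : measure_display} {Omega : measurableType d}.
Context {P : probability Omega R} {m : nat} {X : 'I_m.+2 -> {RV P >-> R}}.
Hypothesis indX : mutually_independent X.
Hypothesis idX : identically_distributed X.
Hypothesis intX : forall i, P.-integrable setT (EFin \o X i).

Let F x := fine (cdf (X ord0) x).

Let measurable_F : measurable_fun setT F.
Proof. by apply: measurableT_comp => //; exact: cdf_measurable. Qed.

Let F_itv x : 0 <= F x <= 1.
Proof.
rewrite /F fine_ge0 ?cdf_ge0//=.
by rewrite -lee_fin fineK ?cdf_le1// fin_num_measure.
Qed.

Let PF x i : P (X i @^-1` `]-oo, x]) = (F x)%:E.
Proof.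
have /(_ `]-oo, x]%classic) := idX i ord0; rewrite /distribution/pushforward => ->//.
by rewrite /F fineK// fin_num_measure.
Qed.

Let w j x : R := F x * (1 - F x) * bernstein m j (F x).

Let measurable_w j : measurable_fun setT (w j).
Proof.
apply: measurable_funM; last first.
  by apply: measurableT_comp => //; exact: measurable_bernstein.
by apply: measurable_funM => //; exact: measurable_funB.
Qed.

(** This is the spacing identity for Lebesgue measure, with n = m + 2; the factor on the left is the
    one for which [bin_bernsteinE] produces [w j]. *)
Lemma expectation_spacing j : (j <= m)%N ->
  ((j.+1%:R * (m.+2 - j - 1)%:R)%:E *
    ('E_P[order_stat X j.+2] - 'E_P[order_stat X j.+1])
  = (m.+2%:R * m.+1%:R)%:E * \int[lebesgue_measure]_x (w j x)%:E)%E.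
Proof.
move=> jm.
rewrite expectation.unlock -integralB_EFin//; last 2 first.
- exact: integrable_order_stat.
- by apply: integrable_order_stat => //; rewrite /= ltnW.
(* A spacing is the length of the interval between consecutive order statistics, that is, the
   integral of its indicator. *)
transitivity ((j.+1%:R * (m.+2 - j - 1)%:R)%:E * \int[P]_w
   \int[(lebesgue_measure : set (measurableTypeR R) -> _)]_x
     (cst 1 x * (order_stat X j.+1 w <= x < order_stat X j.+2 w)%R%:R)%:E)%E.
  congr (_ * _)%E; apply: eq_integral => w0 _.
  rewrite -EFinB -integral_itv_indic; last first.
    by apply: le_order_stat => //=; rewrite leqnSn.
  by apply: eq_integral => x _; rewrite mul1r.
rewrite (@integral_order_stat_between _ _ _ _ _ _ indX _
  (measurableTypeR R) lebesgue_measure id (cst 1) F)//.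
have mC : measurable_fun setT (fun t : R =>
    'C(m.+2, j.+1)%:R * (F t ^+ j.+1 * (1 - F t) ^+ (m.+2 - j.+1))).
  apply: measurable_funM => //; apply: measurable_funM; apply: measurable_funX => //.
  exact: measurable_funB.
have F0 x : 0 <= F x by have /andP[] := F_itv x.
have F1 x : 0 <= 1 - F x by have /andP[_] := F_itv x; rewrite subr_ge0.
transitivity ((j.+1%:R * (m.+2 - j - 1)%:R)%:E * \int[lebesgue_measure]_x
    ('C(m.+2, j.+1)%:R * (F x ^+ j.+1 * (1 - F x) ^+ (m.+2 - j.+1)))%:E)%E.
  by congr (_ * _)%E; apply: eq_integral => x _; rewrite mul1r.
rewrite -!ge0_integralZl//.
- by apply: eq_integral => x _; rewrite -!EFinM bin_bernsteinE.
- by apply/measurable_EFinP; exact: measurable_w.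
- by move=> x _; rewrite lee_fin /w mulr_ge0 ?bernstein_ge0// mulr_ge0.
- exact/measurable_EFinP.
- by move=> x _; rewrite lee_fin !mulr_ge0// exprn_ge0.
Qed.

Lemma order_stats_bernstein (beta : nat -> R) :
  (forall j, (1 <= j <= m.+2)%N -> 'E_P[order_stat X j]%E = (beta j)%:E) ->
  (forall i, (1 <= i < m.+2)%N -> beta i < beta i.+1) ->
  let S := \sum_(1 <= i < m.+2) i%:R * (m.+2 - i)%:R * (beta i.+1 - beta i) in
  exists (d' : measure_display) (Omega' : measurableType d')
         (Q : probability Omega' R) (T : {RV Q >-> R}),
    Q [set x | 0 < T x < 1] = 1%E /\
    forall j, (j <= m)%N ->
      (j.+1%:R * (m.+2 - j - 1)%:R * (beta j.+2 - beta j.+1) / S)%:E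
      = 'E_Q[fun x => bernstein m j (T x)]%E.
Proof.
move=> betaE beta_lt S.
pose K : R := m.+2%:R * m.+1%:R; have K0 : 0 < K by rewrite mulr_gt0.
pose b j : R := j.+1%:R * (m.+2 - j - 1)%:R * (beta j.+2 - beta j.+1).
have SE : S = \sum_(j < m.+1) b j.
  rewrite /S big_add1/= big_mkord; apply: eq_bigr => j _.
  by rewrite /b -subnDA addn1.
have b_gt0 j : (j <= m)%N -> 0 < b j.
  move=> jm; rewrite /b mulr_gt0 ?mulr_gt0 ?ltr0n ?subr_gt0 ?beta_lt//.
  by lia.
have S0 : 0 < S.
  rewrite SE big_ord_recl ltr_pwDl ?b_gt0// sumr_ge0// => i _.
  by rewrite ltW// b_gt0// -ltnS ltn_ord.
have IE j : (j <= m)%N -> (\int[lebesgue_measure]_x (w j x)%:E = (b j / K)%:E)%E.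
  move=> jm; have := expectation_spacing j jm.
  rewrite !betaE; [|lia..].
  rewrite -EFinB -EFinM => bE.
  rewrite /b mulrC EFinM bE muleA -EFinM mulVf ?mul1e//.
  exact: lt0r_neq0.
have F0 x : 0 <= F x by have /andP[] := F_itv x.
have F1 x : 0 <= 1 - F x by have /andP[_] := F_itv x; rewrite subr_ge0.
have w_ge0 j x : 0 <= w j x by rewrite mulr_ge0 ?bernstein_ge0// mulr_ge0.
have sumw x : \sum_(j < m.+1) w j x = F x * (1 - F x).
  rewrite -mulr_sumr; have := sum_bin_bernstein m 0 (F x) isT.
  rewrite bin0 expr0 mulr1; under eq_bigr do rewrite bin0 mul1r.
  by move=> ->; rewrite mulr1.
(* Summing [IE] over [j] with the partition of unity shows that F (1 - F) has integral S / K, whence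
   the normalizing constant. *)
pose g x := F x * (1 - F x) * (K / S).
have mg : measurable_fun setT g.
  apply: measurable_funM => //; apply: measurable_funM => //.
  exact: measurable_funB.
have g_ge0 x : 0 <= g x by rewrite /g !mulr_ge0 ?invr_ge0// ltW.
have g1 : (\int[(lebesgue_measure : set (measurableTypeR R) -> _)]_x (g x)%:E = 1)%E.
  transitivity ((K / S)%:E * \int[lebesgue_measure]_x
    (\sum_(j < m.+1) (w j x)%:E))%E.
    rewrite -ge0_integralZl//.
    + by apply: eq_integral => x _; rewrite sumEFin sumw -EFinM mulrC.
    + apply: emeasurable_sum => j.
      by apply/measurable_EFinP; exact: measurable_w.
    + by move=> x _; rewrite sume_ge0// => j _; rewrite lee_fin.
    + by rewrite lee_fin divr_ge0// ltW.
  rewrite ge0_integral_sum//.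
  + rewrite (eq_bigr (fun j : 'I_m.+1 => (b j / K)%:E)); last first.
      by move=> j _; rewrite IE// -ltnS.
    rewrite sumEFin -mulr_suml -SE -EFinM mulrA divfK ?gt_eqF//.
    by rewrite divff// gt_eqF.
  + by move=> j; apply/measurable_EFinP; exact: measurable_w.
  + by move=> j x _; rewrite lee_fin.
pose Q := density_prob lebesgue_measure g mg g_ge0 g1.
have mT : measurable_fun [set: measurableTypeR R] F by [].
(* The space is the real line under [Q], and [T] is [F] itself. Where [F] equals 0 or 1 the density
   vanishes, so these points have no mass. *)
exists _, (measurableTypeR R), Q, (rv_of_fun Q F mT); split.
  rewrite -g1 /Q/= /density_prob integral_mkcond; apply: eq_integral => x _.
  rewrite patchE; case: ifPn => //.
  rewrite notin_setE/= => /negP; rewrite !lt_neqAle F0 -subr_ge0 F1 !andbT /=.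
  rewrite negb_and !negbK /g => /orP[] /eqP Fx.
    by rewrite -Fx !mul0r.
  by rewrite Fx subrr mulr0 mul0r.
move=> j jm.
rewrite expectation.unlock integral_density_prob//=; last 2 first.
- by apply: measurableT_comp => //; exact: measurable_bernstein.
- by move=> x; rewrite bernstein_ge0.
transitivity ((K / S)%:E * \int[lebesgue_measure]_x (w j x)%:E)%E.
  by rewrite IE// -EFinM -/(b j) mulrACA mulrC mulrA; congr EFin; field;
    rewrite !gt_eqF.
rewrite -ge0_integralZl//.
- apply: eq_integral => x _; rewrite -EFinM /w /g; congr EFin; ring.
- by apply/measurable_EFinP; exact: measurable_w.
- by move=> x _; rewrite lee_fin.
- by rewrite lee_fin divr_ge0// ltW.
Qed.

End spacings.

(** * Existence of i.i.d. uniform variables *)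

(** A product rule over a subfamily [J] is the full one with the whole line as the set at each index
    outside [J]. *)
Lemma mutually_independent_full (R : realType) d (Omega : measurableType d)
    (P : probability Omega R) (I : finType) (X : I -> {RV P >-> R}) :
  (forall A : I -> set R, (forall i, measurable (A i)) ->
    P (\bigcap_i (X i @^-1` A i)) = (\prod_i P (X i @^-1` A i))%E) ->
  mutually_independent X.
Proof.
move=> indX J A mA.
pose B i := if i \in J then A i else setT.
rewrite (_ : \bigcap_(i in _) _ = \bigcap_i (X i @^-1` B i)); last first.
  apply/seteqP; split => [w wA i _ /=|w wB i /= iJ].
    by rewrite /B; case: ifPn => // iJ; exact: wA.
  by have := wB i Logic.I; rewrite /B/= iJ.
rewrite indX; last first.
  by move=> i; rewrite /B; case: ifPn => // iJ; exact: mA.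
rewrite [RHS]big_mkcond/=; apply: eq_bigr => i _; rewrite /B.
by case: ifP => // _; rewrite preimage_setT probability_setT.
Qed.

Lemma mutually_independent_comp (R : realType) d (Omega : measurableType d)
    (P : probability Omega R) (I : finType) (X Y : I -> {RV P >-> R})
    (f : R -> R) : measurable_fun setT f ->
  (forall i w, Y i w = f (X i w)) ->
  mutually_independent X -> mutually_independent Y.
Proof.
move=> mf YfX indX J A mA.
have YE i : Y i @^-1` A i = X i @^-1` (f @^-1` A i).
  by apply/seteqP; split => w /=; rewrite YfX.
rewrite (eq_bigcapr (fun i _ => YE i)) indX; last first.
  by move=> i iJ; rewrite -[X in measurable X]setTI; apply: mf => //; exact: mA.
by apply: eq_bigr => i _; rewrite YE.
Qed.

(** By induction, the space is multiplied by one more copy of the line under [mu]; the new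
    coordinate gets index [ord0] and the old ones are lifted. *)
Lemma iid_exists (R : realType) (mu : probability (measurableTypeR R) R)
    (n : nat) :
  exists (d : measure_display) (Omega : measurableType d)
         (P : probability Omega R) (U : 'I_n -> {RV P >-> R}),
    mutually_independent U /\
    forall i A, measurable A -> P (U i @^-1` A) = mu A.
Proof.
elim: n => [|n [d [ Omega [P [U [indU UE]]]]]].
  (* ['I_0] is empty, so any probability space serves here. *)
  exists _, (measurableTypeR R), mu, (fun=> rv_of_fun mu
    (fun x : measurableTypeR R => x : R) (@measurable_id _ _ _)).
  split; last by case.
  apply: mutually_independent_full => A mA.
  rewrite big_ord0 (_ : \bigcap_i _ = setT) ?probability_setT//.
  by apply/seteqP; split => // x _; case.
pose Q : probability (Omega * measurableTypeR R)%type R := (P \x mu)%E.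
have mV (i : 'I_n.+1) : measurable_fun setT (fun z : Omega * measurableTypeR R =>
    (if unlift ord0 i is Some k then U k z.1 else z.2) : R).
  by case: (unlift ord0 i) => [k|] //; exact: measurableT_comp.
pose V (i : 'I_n.+1) : {RV Q >-> R} := rv_of_fun Q _ (mV i).
have V0 A : V ord0 @^-1` A = setT `*` A.
  apply/seteqP; split => z /=; rewrite unlift_none//=; tauto.
have VS k A : V (lift ord0 k) @^-1` A = (U k @^-1` A) `*` setT.
  by apply/seteqP; split => z /=; rewrite liftK//=; tauto.
have mU k A : measurable A -> measurable (U k @^-1` A) by exact: measurable_funPTI.
have QV0 A : measurable A -> Q (V ord0 @^-1` A) = mu A.
  move=> mA; rewrite V0; transitivity (P setT * mu A)%E.
    exact: product_measure1E.
  by rewrite probability_setT mul1e.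
have QVS k A : measurable A -> Q (V (lift ord0 k) @^-1` A) = P (U k @^-1` A).
  move=> mA; rewrite VS; transitivity (P (U k @^-1` A) * mu setT)%E.
    by apply: product_measure1E => //; exact: mU.
  by rewrite probability_setT mule1.
exists _, (Omega * measurableTypeR R)%type, Q, V; split; last first.
  move=> i A mA; have [->|[k ->]] : i = ord0 \/ exists k : 'I_n, i = lift ord0 k.
    by case: (unliftP ord0 i) => [k ->|]; [right; exists k|left].
  - exact: QV0.
  - by rewrite QVS// UE.
apply: mutually_independent_full => A mA.
rewrite big_ord_recl QV0//; under eq_bigr do rewrite QVS//.
rewrite (_ : \bigcap_i _ =
    (\bigcap_k (U k @^-1` A (lift ord0 k))) `*` A ord0); last first.
  apply/seteqP; split => [z zA|z [zU z0] i _].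
    split; last by have := zA ord0 I; rewrite -/((V ord0 @^-1` A ord0) z) V0 => -[].
    move=> k _; have := zA (lift ord0 k) I.
    by rewrite -/((V _ @^-1` A _) z) VS => -[].
  have [->|[k ->]] : i = ord0 \/ exists k : 'I_n, i = lift ord0 k.
    by case: (unliftP ord0 i) => [k ->|]; [right; exists k|left].
  - by rewrite V0.
  - by rewrite VS; split => //; exact: zU.
transitivity (P (\bigcap_k (U k @^-1` A (lift ord0 k))) * mu (A ord0))%E.
  apply: product_measure1E; last exact: mA.
  apply: fin_bigcap_measurable => [|k _]; first exact: finite_finset.
  exact: mU.
rewrite muleC; congr (_ * _)%E.
have := indU [set: 'I_n]%SET (fun k => A (lift ord0 k)) (fun k _ => mA _).
rewrite (_ : [set` _] = setT); last by apply/seteqP; split => k //= _; rewrite inE.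
by move=> ->; apply: eq_bigl => k; rewrite inE.
Qed.

Lemma measurable_natr_bool {R : realType} {d} {T : measurableType d}
    (b : T -> bool) :
  measurable_fun setT b -> measurable_fun setT (fun x => (b x)%:R : R).
Proof.
move=> mb; rewrite (_ : (fun _ => _) = fun x => if b x then 1 else 0).
  exact: measurable_fun_if.
by apply/funext => x; case: (b x).
Qed.

(** The uniform law has the indicator of ]0, 1[ as density. Clamping then gives values in ]0, 1[
    everywhere, and the law is unaffected because the density lives where [clamp01] is the
    identity. *)
Lemma exists_iid_uniform (R : realType) (n : nat) :
  exists (d : measure_display) (Omega : measurableType d)
         (P : probability Omega R) (V : 'I_n -> {RV P >-> R}),
    [/\ mutually_independent V, identically_distributed V,
        forall i w, 0 < V i w < 1 &
        forall i t, 0 < t < 1 -> P (V i @^-1` `]-oo, t]) = t%:E].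
Proof.
pose g (x : measurableTypeR R) : R := (0 < x < 1)%R%:R.
have gE : g = \1_(`]0, 1[ : set R).
  apply/funext => x; rewrite indicE /g; congr (nat_of_bool _)%:R.
  by apply/idP/idP; rewrite inE/= in_itv.
have mg : measurable_fun setT g by rewrite gE; exact: measurable_indic.
have g0 x : 0 <= g x by rewrite /g.
have gI (A : set (measurableTypeR R)) : measurable A ->
    (\int[lebesgue_measure]_(x in A) (g x)%:E
     = (lebesgue_measure : set (measurableTypeR R) -> \bar R) (`]0%R, 1%R[ `&` A))%E.
  by move=> mA; rewrite gE integral_indic.
have g1 : (\int[lebesgue_measure]_x (g x)%:E = 1)%E.
  by rewrite gI// setIT lebesgue_measure_itv/= lte_fin ltr01 oppr0 adde0.
pose mu : probability (measurableTypeR R) R :=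
  density_prob lebesgue_measure g mg g0 g1.
have [d [ Omega [P [U [indU UE]]]]] := iid_exists _ mu n.
have mV i : measurable_fun setT (fun w => clamp01 (U i w)).
  by apply: measurableT_comp => //; exact: measurable_clamp01.
pose V i := rv_of_fun P _ (mV i).
have VA i A : measurable A -> P (V i @^-1` A) = mu (clamp01 @^-1` A).
  move=> mA; rewrite -(UE i)//.
  by rewrite -[X in measurable X]setTI; exact: measurable_clamp01.
exists d, Omega, P, V; split.
- exact: (mutually_independent_comp _ _ _ _ _ U V clamp01 measurable_clamp01).
- by move=> i j A mA; rewrite /distribution/pushforward !VA.
- by move=> i w; exact: clamp01_itv.
- move=> i t /andP[t0 t1]; rewrite VA//.
  transitivity ((lebesgue_measure : set (measurableTypeR R) -> \bar R)
    `]0%R, t]%classic)%E.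
    rewrite -[LHS]/(\int[lebesgue_measure]_(x in _) (g x)%:E)%E gI; last first.
      by rewrite -[X in measurable X]setTI; exact: measurable_clamp01.
    congr lebesgue_measure; apply/seteqP; split => x /=; rewrite !in_itv/=.
      by move=> [x01]; rewrite clamp01_id// => ->; have /andP[->] := x01.
    move=> /andP[x0 xt]; have x01 : 0 < x < 1 by rewrite x0 (le_lt_trans xt).
    by rewrite clamp01_id.
  by rewrite lebesgue_measure_itv/= lte_fin t0 oppr0 adde0.
Qed.

(** * The monotone function G that transports uniform variables *)

Section quantile.
Context {R : realType} {d : measure_display} {Omega : measurableType d}.
Context {Q : probability Omega R} (T : {RV Q >-> R}).
Hypothesis T01 : forall t, 0 < T t < 1.
Variable c : R.
Hypothesis c0 : 0 < c.

(** This is the density of nu against the law of [T], pulled back to [Omega]. *)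
Definition quantile_weight (t : Omega) : R := c / (T t * (1 - T t)).
Local Notation k := quantile_weight.

(** [Gp] and [Gm] carry the mass on [1/2, u[ and on [u, 1/2[; at most one of the two intervals is
    nonempty. They are half-open to match [order_stat_between]. *)
Let Gp (z : R * Omega) : R := (2^-1 <= T z.2 < z.1)%R%:R * k z.2.
Let Gm (z : R * Omega) : R := (z.1 <= T z.2 < 2^-1)%R%:R * k z.2.

(* The primitive of nu(dt) = c P_T(dt) / (t (1 - t)) vanishing at 1/2; nu may
   have infinite mass near 0 and 1, so the two sides are treated separately. *)
Definition quantile_fun (u : R) : R :=
  fine (\int[Q]_t (Gp (u, t))%:E) - fine (\int[Q]_t (Gm (u, t))%:E).
Local Notation G := quantile_fun.

Lemma quantile_weight_ge0 t : 0 <= k t.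
Proof.
have /andP[t0 t1] := T01 t.
by rewrite /k divr_ge0 ?mulr_ge0 ?subr_ge0// ltW.
Qed.

Lemma measurable_quantile_weight : measurable_fun setT k.
Proof.
apply: measurable_funM => //.
(* The argument is positive, so its inverse is a composition of measurable functions. *)
rewrite (_ : (fun _ => _) = fun t => expR (- ln (T t * (1 - T t)))); last first.
  apply/funext => t; have /andP[t0 t1] := T01 t.
  by rewrite expRN lnK// posrE mulr_gt0 ?subr_gt0.
apply: measurableT_comp; first exact: measurable_expR.
apply: measurableT_comp => //; apply: measurableT_comp; first exact: measurable_ln.
by apply: measurable_funM => //; exact: measurable_funB.
Qed.

Let Gp_ge0 z : 0 <= Gp z.
Proof. by rewrite mulr_ge0 ?quantile_weight_ge0. Qed.

Let Gm_ge0 z : 0 <= Gm z.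
Proof. by rewrite mulr_ge0 ?quantile_weight_ge0. Qed.

Let measurable_Gp : measurable_fun setT Gp.
Proof.
apply: measurable_funM; last first.
  by apply: measurableT_comp => //; exact: measurable_quantile_weight.
apply: measurable_natr_bool; apply: measurable_and => //.
  by apply: measurable_fun_ler => //; exact: measurableT_comp.
by apply: measurable_fun_ltr => //; exact: measurableT_comp.
Qed.

Let measurable_Gm : measurable_fun setT Gm.
Proof.
apply: measurable_funM; last first.
  by apply: measurableT_comp => //; exact: measurable_quantile_weight.
apply: measurable_natr_bool; apply: measurable_and => //.
  by apply: measurable_fun_ler => //; exact: measurableT_comp.
by apply: measurable_fun_ltr => //; exact: measurableT_comp.
Qed.

(** On [1/2, u[ the function t (1 - t) stays above its value at [u], so for fixed [u] the integrand
    is bounded even if the weight is not. *)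
Let Gp_le u t : 0 < u < 1 -> Gp (u, t) <= c / (u * (1 - u)).
Proof.
move=> /andP[u0 u1]; have /andP[t0 t1] := T01 t.
rewrite /Gp /k/=; have [/andP[h1 h2]|_] /= := boolP (2^-1 <= T t < u); last first.
  by rewrite mul0r divr_ge0 ?mulr_ge0 ?subr_ge0// ltW.
rewrite mul1r ler_pM2l// lef_pV2 ?posrE ?mulr_gt0 ?subr_gt0//.
rewrite -subr_ge0; nra.
Qed.

Let Gm_le u t : 0 < u < 1 -> Gm (u, t) <= c / (u * (1 - u)).
Proof.
move=> /andP[u0 u1]; have /andP[t0 t1] := T01 t.
rewrite /Gm /k/=; have [/andP[h1 h2]|_] /= := boolP (u <= T t < 2^-1); last first.
  by rewrite mul0r divr_ge0 ?mulr_ge0 ?subr_ge0// ltW.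
rewrite mul1r ler_pM2l// lef_pV2 ?posrE ?mulr_gt0 ?subr_gt0//.
rewrite -subr_ge0; nra.
Qed.

Let bounded_fin_num (f : Omega -> R) (M : R) : measurable_fun setT f ->
  (forall t, 0 <= f t <= M) -> (\int[Q]_t (f t)%:E)%E \is a fin_num.
Proof.
move=> mf f0M; apply: integrable_fin_num => //.
apply: measurable_bounded_integrable => //.
- by rewrite (le_lt_trans (probability_le1 Q measurableT))// ltry.
- exists M; split; first exact: num_real.
  move=> x Mx t _ /=; have /andP[f0 fM] := f0M t.
  by rewrite ger0_norm// (le_trans fM)// ltW.
Qed.

Let msec (f : R * Omega -> R) u : measurable_fun setT f ->
  measurable_fun setT (fun t => f (u, t)).
Proof. by move=> mf; apply: measurableT_comp => //; exact: measurable_pair1. Qed.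

Let Gp_fin u : 0 < u < 1 -> (\int[Q]_t (Gp (u, t))%:E)%E \is a fin_num.
Proof.
move=> u01; apply: (@bounded_fin_num _ (c / (u * (1 - u)))); first exact: msec.
by move=> t; rewrite Gp_ge0 Gp_le.
Qed.

Let Gm_fin u : 0 < u < 1 -> (\int[Q]_t (Gm (u, t))%:E)%E \is a fin_num.
Proof.
move=> u01; apply: (@bounded_fin_num _ (c / (u * (1 - u)))); first exact: msec.
by move=> t; rewrite Gm_ge0 Gm_le.
Qed.

Lemma measurable_quantile_fun : measurable_fun setT G.
Proof.
apply: measurable_funB.
  apply: measurableT_comp; first exact: fine_measurable.
  apply: (@measurable_fun_fubini_tonelli_F _ _ _ _ _ Q (EFin \o Gp)) => //.
  by apply/measurable_EFinP.
apply: measurableT_comp; first exact: fine_measurable.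
apply: (@measurable_fun_fubini_tonelli_F _ _ _ _ _ Q (EFin \o Gm)) => //.
by apply/measurable_EFinP.
Qed.

Lemma quantile_funB u v : 0 < u < 1 -> 0 < v < 1 -> u <= v ->
  ((G v - G u)%:E = \int[Q]_t (k t * (u <= T t < v)%R%:R)%:E)%E.
Proof.
move=> u01 v01 uv.
have mI : measurable_fun setT (fun t => k t * (u <= T t < v)%R%:R).
  apply: measurable_funM; first exact: measurable_quantile_weight.
  by apply: measurable_natr_bool; apply: measurable_and => //;
    [apply: measurable_fun_ler|apply: measurable_fun_ltr].
have I0 t : 0 <= k t * (u <= T t < v)%R%:R by rewrite mulr_ge0 ?quantile_weight_ge0.
have mp x : measurable_fun setT (fun t => (Gp (x, t))%:E).
  by apply/measurable_EFinP; exact: msec.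
have mm x : measurable_fun setT (fun t => (Gm (x, t))%:E).
  by apply/measurable_EFinP; exact: msec.
(* The difference is rearranged into sums of nonnegative integrals, so that additivity applies
   before anything is known to be finite. The four integrals of [Gp] and [Gm] are finite, which then
   forces the last one to be. *)
have E : (\int[Q]_t (Gp (v, t))%:E + \int[Q]_t (Gm (u, t))%:E
  = \int[Q]_t (Gp (u, t))%:E + \int[Q]_t (Gm (v, t))%:E
    + \int[Q]_t (k t * (u <= T t < v)%R%:R)%:E)%E.
  rewrite -!ge0_integralD//=; try by move=> t _; rewrite ?adde_ge0 ?lee_fin.
  - apply: eq_integral => t _; rewrite -!EFinD; congr EFin.
    rewrite /Gp /Gm /= [k t * _]mulrC -!mulrDl; congr (_ * _).
    case: (leP 2^-1 (T t)) => h1; case: (ltP (T t) v) => h2;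
      case: (ltP (T t) u) => h3; case: (ltP (T t) 2^-1) => h4 //=;
      rewrite ?addr0 ?add0r//; lra.
  - exact: emeasurable_funD.
  - exact/measurable_EFinP.
move: E; rewrite /G.
rewrite -(fineK (Gp_fin _ u01)) -(fineK (Gp_fin _ v01)).
rewrite -(fineK (Gm_fin _ u01)) -(fineK (Gm_fin _ v01)) /=.
case: (\int[Q]_t (k t * _)%:E)%E => [r| |]//; rewrite -!EFinD => -[E].
by congr EFin; lra.
Qed.

Lemma quantile_fun_homo : {in [pred u | 0 < u < 1] &, {homo G : u v / u <= v}}.
Proof.
move=> u v; rewrite !inE => u01 v01 uv; rewrite -subr_ge0 -lee_fin quantile_funB//.
by apply: integral_ge0 => t _; rewrite lee_fin mulr_ge0 ?quantile_weight_ge0.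
Qed.

(** |G(V)| is at most the integral over [t] of [Gp] plus [Gm]. Exchanging integrals, the uniform
    tail 1 - T or T cancels one factor of the weight, which leaves c / T or c / (1 - T) on the side
    of 1/2 where it is at most 2c. *)
Lemma integrable_quantile_fun d' (Omega' : measurableType d')
    (P : probability Omega' R) (V : {RV P >-> R}) :
  (forall w, 0 < V w < 1) ->
  (forall t, 0 < t < 1 -> P (V @^-1` `]-oo, t]) = t%:E) ->
  P.-integrable setT (fun w => (G (V w))%:E).
Proof.
move=> V01 PV.
pose h (f : R * Omega -> R) (z : Omega' * Omega) := f (V z.1, z.2).
have mh f : measurable_fun setT f -> measurable_fun setT (h f).
  move=> mf; apply: measurableT_comp => //; apply: measurable_fun_pair => //=.
  exact: measurableT_comp.
pose H (z : Omega' * Omega) := (h Gp z + h Gm z)%:E.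
have mH : measurable_fun setT H.
  by apply/measurable_EFinP; apply: measurable_funD; apply: mh.
have H0 z : (0 <= H z)%E by rewrite lee_fin /h addr_ge0 ?Gp_ge0 ?Gm_ge0.
have PH t : (\int[P]_w H (w, t) <= (2 * c)%:E)%E.
  have /andP[t0 t1] := T01 t.
  pose A := V @^-1` `]-oo, T t].
  have mA : measurable A by exact: measurable_funPTI.
  have PA : P A = (T t)%:E by exact: PV.
  have memA w : (w \in A) = (V w <= T t).
    by apply/idP/idP => [/set_mem|VT]; [|apply/mem_set]; rewrite /A/= in_itv.
  have IB (B : set Omega') : measurable B ->
      (forall w, H (w, t) = ((k t)%:E * (\1_B w)%:E)%E) ->
      (\int[P]_w H (w, t) = (k t)%:E * P B)%E.
    move=> mB HB; under eq_integral do rewrite HB.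
    rewrite ge0_integralZl//.
    - by rewrite integral_indic// setIT.
    - exact/measurable_EFinP/measurable_indic.
    - by rewrite lee_fin quantile_weight_ge0.
  (* For T t >= 1/2 only [Gp] contributes, on the event V > T t; otherwise only [Gm] does, on V <= T
     t. *)
  have [ht|ht] := leP 2^-1 (T t).
    rewrite (IB (~` A)); last 2 first.
    - exact: measurableC.
    - move=> w; rewrite /H /h /Gp /Gm /= -EFinM; congr EFin.
      rewrite [T t < 2^-1]ltNge ht andbF mul0r addr0 mulrC indicE in_setC /=.
      by rewrite memA ltNge.
    rewrite probability_setC// PA -EFinB -EFinM lee_fin /k.
    have -> : c / (T t * (1 - T t)) * (1 - T t) = c / T t.
      by field; rewrite !gt_eqF// subr_gt0.
    rewrite ler_pdivrMr//.
    have : 0 <= c * (T t - 2^-1) by rewrite mulr_ge0 ?subr_ge0// ltW.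
    by rewrite mulrBr; lra.
  rewrite (IB A) => //.
  - rewrite PA -EFinM lee_fin /k.
    have -> : c / (T t * (1 - T t)) * T t = c / (1 - T t).
      by field; rewrite !gt_eqF// subr_gt0.
    rewrite ler_pdivrMr ?subr_gt0//.
    have : 0 <= c * (2^-1 - T t) by rewrite mulr_ge0 ?subr_ge0// ltW.
    by rewrite !mulrBr; lra.
  - move=> w; rewrite /H /h /Gp /Gm /= -EFinM; congr EFin.
    rewrite leNgt ht/= mul0r add0r andbT mulrC indicE.
    by rewrite memA.
pose F w := (\int[Q]_t H (w, t))%E.
have mF : measurable_fun setT F by exact: (measurable_fun_fubini_tonelli_F H).
have F0 w : (0 <= F w)%E by exact: integral_ge0.
apply: (@le_integrable _ _ _ _ _ _ _ F) => //.
- apply/measurable_EFinP; apply: measurableT_comp => //.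
  exact: measurable_quantile_fun.
- move=> w _; rewrite (gee0_abs (F0 w)) /F /H /=.
  have Vw := V01 w.
  under eq_integral do rewrite EFinD.
  rewrite ge0_integralD//; last 4 first.
  - by move=> t _; rewrite lee_fin Gp_ge0.
  - by apply/measurable_EFinP; exact: (msec Gp (V w) measurable_Gp).
  - by move=> t _; rewrite lee_fin Gm_ge0.
  - by apply/measurable_EFinP; exact: (msec Gm (V w) measurable_Gm).
  rewrite /h/= -(fineK (Gp_fin _ Vw)) -(fineK (Gm_fin _ Vw)) -EFinD lee_fin.
  rewrite (le_trans (ler_normB _ _))// !ger0_norm// fine_ge0// integral_ge0//.
  - by move=> t _; rewrite lee_fin ?Gp_ge0 ?Gm_ge0.
  - by move=> t _; rewrite lee_fin ?Gp_ge0 ?Gm_ge0.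
apply/integrableP; split => //.
under eq_integral do rewrite gee0_abs//.
rewrite (fubini_tonelli H)//.
apply: (@le_lt_trans _ _ (\int[Q]_t (2 * c)%:E)%E); last first.
  by rewrite integral_cst// [X in (_ * X)%E](probability_setT Q) mule1 ltry.
apply: ge0_le_integral => //.
- by move=> t _; exact: integral_ge0.
- exact: (measurable_fun_fubini_tonelli_G H).
Qed.

End quantile.

(** * From Bernstein moments to order statistics: (ii) implies (i) *)

(** Equality of laws gives each event [X i = c] probability 1, and so does their product. This makes
    all order statistics coincide almost surely. *)
Lemma iid_degenerate (R : realType) d (Omega : measurableType d)
    (P : probability Omega R) (I : finType) (X : I -> {RV P >-> R})
    (i0 : I) (c : R) :
  mutually_independent X -> identically_distributed X ->
  {ae P, forall w, X i0 w = c} ->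
  {ae P, forall w, forall i, X i w = c}.
Proof.
move=> indX idX Xc.
have PX i : P (X i @^-1` [set c]) = 1%E.
  rewrite -[LHS]/(distribution P (X i) [set c]) (idX i i0)//.
  rewrite /distribution/pushforward.
  case: Xc => N [mN PN XN].
  have mc : measurable (X i0 @^-1` [set c]) by exact: measurable_funPTI.
  have : P (~` (X i0 @^-1` [set c])) = 0%E.
    apply/eqP; rewrite eq_le measure_ge0 andbT -PN.
    by apply: le_measure; rewrite ?inE//; exact: measurableC.
  move=> PXc; have := probability_setC P (measurableC mc).
  by rewrite setCK PXc sube0.
pose E := \bigcap_(i in [set` [set: I]%SET]) (X i @^-1` [set c]).
have mE : measurable E.
  apply: fin_bigcap_measurable => [|i _]; first exact: finite_finset.
  exact: measurable_funPTI.
have PE : P E = 1%E.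
  by rewrite indX// big1.
exists (~` E); split; first exact: measurableC.
  have := probability_setC P mE; rewrite PE subee// => ->.
move=> w /= + wE; apply => i.
by apply: wE => /=; rewrite inE.
Qed.

Lemma bernstein_order_stats (R : realType) (m : nat) (beta : nat -> R)
    d (Omega : measurableType d) (Q : probability Omega R) (T : {RV Q >-> R}) :
  (forall i, (1 <= i < m.+2)%N -> beta i < beta i.+1) ->
  let S := \sum_(1 <= i < m.+2) i%:R * (m.+2 - i)%:R * (beta i.+1 - beta i) in
  (forall t, 0 < T t < 1) ->
  (forall j, (j <= m)%N ->
      (j.+1%:R * (m.+2 - j - 1)%:R * (beta j.+2 - beta j.+1) / S)%:E
      = 'E_Q[fun x => bernstein m j (T x)]%E) ->
  expected_order_stats m.+2 beta.
Proof.
move=> beta_lt S T01 TE.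
pose K : R := m.+2%:R * m.+1%:R; have K0 : 0 < K by rewrite mulr_gt0.
have S0 : 0 < S.
  rewrite /S big_nat_recl// ltr_pwDl//.
    by rewrite !mulr_gt0 ?ltr0n ?subr_gt0 ?beta_lt.
  rewrite big_nat sumr_ge0// => i /andP[_ im].
  by rewrite !mulr_ge0// subr_ge0 ltW// beta_lt//.
pose c := S / K; have c0 : 0 < c by rewrite divr_gt0.
pose G := quantile_fun T c.
have [d' [ Omega' [P [V [indV idV V01 PV]]]]] := exists_iid_uniform R m.+2.
have mG : measurable_fun setT G by exact: measurable_quantile_fun.
have osV01 j w : (0 < j <= m.+2)%N -> 0 < order_stat V j w < 1.
  by move=> jm; have [i ->] := order_stat_mem V j w jm.
pose mean1 := fine (\int[P]_w (G (order_stat V 1 w))%:E)%E.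
(* The spacings determine the means up to a common constant; this shift makes the first one equal to
   [beta 1]. *)
pose Gb u := G u + (beta 1 - mean1).
have mGb : measurable_fun setT Gb by exact: measurable_funD.
have mX i : measurable_fun setT (fun w => Gb (V i w)) by exact: measurableT_comp.
pose X i : {RV P >-> R} := rv_of_fun P _ (mX i).
have intGV i : P.-integrable setT (fun w => (G (V i w))%:E).
  by apply: integrable_quantile_fun => // t t01; exact: PV.
have intk (r : R) : P.-integrable setT (EFin \o cst r).
  exact: finite_measure_integrable_cst.
have intX i : P.-integrable setT (EFin \o X i).
  have := integrableD measurableT (intGV i) (intk (beta 1 - mean1)).
  by apply: eq_integrable => // w _.
have indX : mutually_independent X.
  exact: (mutually_independent_comp _ _ _ _ _ V X Gb mGb).
have idX : identically_distributed X.
  move=> i j A mA; rewrite /distribution/pushforward.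
  have XV k : X k @^-1` A = V k @^-1` (Gb @^-1` A) by [].
  rewrite !XV; apply: idV; rewrite -[Y in measurable Y]setTI.
  exact: mGb.
have osX j w : (0 < j <= m.+2)%N -> order_stat X j w = Gb (order_stat V j w).
  move=> jm; apply: (@order_stat_comp _ _ _ _ _ V X Gb [pred u | 0 < u < 1]) => //.
    by move=> u v u01 v01 uv; rewrite lerD2r; apply: (quantile_fun_homo _ T01 _ c0).
  by move=> i; rewrite inE; exact: V01.
have intos j : (0 < j <= m.+2)%N -> P.-integrable setT (EFin \o order_stat X j).
  by move=> jm; exact: integrable_order_stat.
have spacing j : (j <= m)%N ->
    ('E_P[order_stat X j.+2] - 'E_P[order_stat X j.+1]
     = (beta j.+2 - beta j.+1)%:E)%E.
  move=> jm.
  have j1 : (0 < j.+1 <= m.+2)%N by lia.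
  have j2 : (0 < j.+2 <= m.+2)%N by lia.
  rewrite expectation.unlock -integralB_EFin//; [|exact: intos..].
  transitivity (\int[P]_w \int[Q]_t (quantile_weight T c t *
     (order_stat V j.+1 w <= T t < order_stat V j.+2 w)%R%:R)%:E)%E.
    apply: eq_integral => w _.
    rewrite !osX// -EFinB -(quantile_funB _ T01 _ c0) ?osV01//; last first.
      by apply: le_order_stat => //=; rewrite leqnSn.
    by rewrite /Gb; congr EFin; rewrite /G; ring.
  (* The threshold is [T], and since [V] is uniform the distribution function at [T t] is again
     [T t]. *)
  rewrite (@integral_order_stat_between _ _ _ _ _ _ indV _ _ Q T _ T)//; last 3 first.
  - exact: measurable_quantile_weight.
  - exact: quantile_weight_ge0.
  - by move=> t i; rewrite PV.
  pose a : R := j.+1%:R * (m.+2 - j - 1)%:R.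
  have a0 : a != 0.
    by rewrite mulf_neq0// pnatr_eq0 -lt0n; lia.
  transitivity (\int[Q]_t ((S / a)%:E * (bernstein m j (T t))%:E))%E.
    apply: eq_integral => t _; rewrite -EFinM; congr EFin.
    have /andP[t0 t1] := T01 t.
    apply: (mulfI a0).
    (* The weight cancels T (1 - T), and c = S / K cancels the factor n (n - 1), leaving [S] times
       the Bernstein polynomial. *)
    rewrite mulrCA bin_bernsteinE// -/K /quantile_weight /c.
    by field; rewrite a0 !gt_eqF// subr_gt0.
  rewrite ge0_integralZl//.
  - have := TE j jm; rewrite expectation.unlock => <-.
    by rewrite -EFinM -/a; congr EFin; field; rewrite a0 gt_eqF.
  - apply/measurable_EFinP; apply: measurableT_comp => //.
    exact: measurable_bernstein.
  - move=> t _; rewrite lee_fin bernstein_ge0//.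
    by have /andP[/ltW-> /ltW->] := T01 t.
  - rewrite lee_fin divr_ge0//; first exact: ltW.
    by rewrite mulr_ge0.
have E1 : ('E_P[order_stat X 1] = (beta 1)%:E)%E.
  have i1 := intos 1 isT; have I1 := integrable_fin_num measurableT i1.
  have GE : (\int[P]_w (G (order_stat V 1 w))%:E
      = \int[P]_w (order_stat X 1 w)%:E - (beta 1 - mean1)%:E)%E.
    have <- : (\int[P]_w (cst (beta 1 - mean1) w)%:E = (beta 1 - mean1)%:E)%E.
      transitivity (\int[P]_w cst (beta 1 - mean1)%:E w)%E => //.
      by rewrite integral_cst// [X in (_ * X)%E](probability_setT P) mule1.
    rewrite -integralB_EFin//; apply: eq_integral => w _.
    by rewrite osX// -EFinB /Gb addrK.
  rewrite expectation.unlock; have := congr1 fine GE.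
  rewrite -/mean1 -(fineK I1) -EFinB /= => mE; congr EFin; lra.
have EE j : (1 <= j <= m.+2)%N -> ('E_P[order_stat X j] = (beta j)%:E)%E.
  case: j => // j /= ; elim: j => // j IH jm.
  have := spacing j jm; rewrite IH ?(ltnW jm)//.
  case: ('E_P[_])%E => [r| |]//; rewrite -EFinB => -[rE].
  by congr EFin; lra.
exists d', Omega', P, X; split => // i [x Xx].
(* If one [X i] were almost surely constant, the first two order statistics would have equal means,
   against [beta 1 < beta 2]. *)
have /(iid_degenerate _ _ _ _ _ _ _ _ indX idX) Xae := Xx.
have : ('E_P[order_stat X 1] = 'E_P[order_stat X 2])%E.
  rewrite expectation.unlock; apply: ae_eq_integral => //.
  - exact/measurable_EFinP/measurable_order_stat.
  - exact/measurable_EFinP/measurable_order_stat.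
  - apply: filterS Xae => w Xw _; congr EFin.
    have [i1 ->] := order_stat_mem X 1 w isT.
    by have [i2 ->] := order_stat_mem X 2 w isT; rewrite !Xw.
rewrite !EE// => -[/eqP]; apply/negP.
by rewrite lt_eqF// beta_lt.
Qed.

(** * Assembly of the equivalences between (i), (ii) and (iii) *)

Theorem theorem1 (R : realType) (n : nat) (n_ge2 : (2 <= n)%N)
    (beta : nat -> R)
    (beta_lt : forall i : nat, (1 <= i < n)%N -> beta i < beta i.+1) :
  let S : R := \sum_(1 <= i < n) i%:R * (n - i)%:R * (beta i.+1 - beta i) in
  let stmt_i := expected_order_stats n beta in
  let stmt_ii :=
    exists (d : measure_display) (Omega : measurableType d)
           (P : probability Omega R) (T : {RV P >-> R}),
      P [set w | 0 < T w < 1] = 1%E /\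
      forall j : nat, (j <= n - 2)%N ->
        (j.+1%:R * (n - j - 1)%:R * (beta j.+2 - beta j.+1) / S)%:E
        = ('E_P[fun w => ('C(n - 2, j)%:R * T w ^+ j
                           * (1 - T w) ^+ (n - 2 - j))%R])%E in
  let stmt_iii :=
    exists (d : measure_display) (Omega : measurableType d)
           (P : probability Omega R) (T : {RV P >-> R}),
      P [set w | 0 < T w < 1] = 1%E /\
      forall k : nat, (k <= n - 2)%N ->
        ((n - 1)%:R / ('C(n - 1, k.+1)%:R * S)
          * \sum_(k.+1 <= j < n)
              (n - j)%:R * 'C(j, k.+1)%:R * (beta j.+1 - beta j))%:E
        = ('E_P[fun w => (T w ^+ k)%R])%E in
  (stmt_i <-> stmt_ii) /\ (stmt_ii <-> stmt_iii).
Proof.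
case: n n_ge2 beta_lt => [|[|m]]// n_ge2 beta_lt S stmt_i stmt_ii stmt_iii.
have n2 : (m.+2 - 2 = m)%N by rewrite !subSS subn0.
rewrite /stmt_ii /stmt_iii n2; split; split.
- move=> [d [ Omega [P [X [indX idX intX _ betaE]]]]].
  by have := order_stats_bernstein indX idX intX beta betaE beta_lt; exact.
- move=> [d [ Omega [Q [T [QT TE]]]]].
  have [T' T'01 TT'] := exists_unit_interval_rv _ _ _ T QT.
  apply: (bernstein_order_stats R m beta _ _ Q T') => // j jm.
  by rewrite TE// (TT' (bernstein m j))//; exact: measurable_bernstein.
- move=> [d [ Omega [Q [T [QT TE]]]]].
  have [T' T'01 TT'] := exists_unit_interval_rv _ _ _ T QT.
  (* The witness remains [T]; the pointwise bounded [T'] only replaces it inside expectations. *)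
  exists d, Omega, Q, T; split => // k km.
  rewrite (TT' (fun x => x ^+ k)); last exact: exprn_measurable.
  rewrite moment_coefE ?n2//.
  apply: (iffLR (bernstein_moments_iff T' T'01 m
    (fun j => j.+1%:R * (m.+2 - j - 1)%:R * (beta j.+2 - beta j.+1) / S)))
    => // j jm.
  by rewrite TE// (TT' (bernstein m j))//; exact: measurable_bernstein.
- move=> [d [ Omega [Q [T [QT TE]]]]].
  have [T' T'01 TT'] := exists_unit_interval_rv _ _ _ T QT.
  exists d, Omega, Q, T; split => // j jm.
  rewrite (TT' (bernstein m j)); last exact: measurable_bernstein.
  apply: (iffRL (bernstein_moments_iff T' T'01 m
    (fun j => j.+1%:R * (m.+2 - j - 1)%:R * (beta j.+2 - beta j.+1) / S)))
    jm => k km.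
  have := TE k km; rewrite moment_coefE ?n2// => ->.
  by rewrite (TT' (fun x => x ^+ k))//; exact: exprn_measurable.
Qed.
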